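(* For any $\mathfrak{a}$-space $(X,\tau,\mathfrak{a})$: if $X$ is compact in $(X,\tau)$ then $X$ is $\mathfrak{a}$-compact; if $X$ is $\mathfrak{a}$-compact then $X$ is countably $\mathfrak{a}$-compact. Moreover, if $X$ is $\mathfrak{a}$-compact then $X$ is $\mathfrak{a}$-Lindelöf.
   Context: An aura topological space (or $\mathfrak{a}$-space) $(X,\tau,\mathfrak{a})$ is a topological space $(X,\tau)$ together with a function $\mathfrak{a}:X\to\tau$ (a scope function) such that $x\in\mathfrak{a}(x)$ for every $x\in X$. A subset $A\subseteq X$ is $\mathfrak{a}$-open if $\mathfrak{a}(x)\subseteq A$ for every $x\in A$; the collection $\tau_{\mathfrak{a}}$ of all $\mathfrak{a}$-open sets is a topology on $X$ with $\tau_{\mathfrak{a}}\subseteq\tau$. The space $X$ is $\mathfrak{a}$-compact if every cover of $X$ by members of $\tau_{\mathfrak{a}}$ has a finite subcover; it is $\mathfrak{a}$-Lindelöf if every cover of $X$ by members of $\tau_{\mathfrak{a}}$ has a countable subcover; it is countably $\mathfrak{a}$-compact if every countable cover of $X$ by members of $\tau_{\mathfrak{a}}$ has a finite subcover. *)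

(* Defs.v *)
From mathcomp Require Import all_boot all_order all_algebra.
From mathcomp Require Import all_classical topology.

Set Implicit Arguments.
Unset Strict Implicit.
Unset Printing Implicit Defensive.

Local Open Scope classical_set_scope.

Record scope_function (X : topologicalType) := ScopeFunction {
  scope_fun :> X -> set X;
  scope_open : forall x, open (scope_fun x);
  scope_mem : forall x, scope_fun x x
}.

Section AuraSpace.
Variables (X : topologicalType) (a : scope_function X).

Definition aura_open (A : set X) : Prop := forall x, A x -> a x `<=` A.

Definition aura_topology : set (set X) := [set A | aura_open A].

(* Covers are sets of subsets of X; a subcover is a subset of the cover that
   still covers X. *)
Definition aura_cover (C : set (set X)) : Prop :=
  C `<=` aura_topology /\ \bigcup_(U in C) U = [set: X].

Definition subcover (C D : set (set X)) : Prop :=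
  D `<=` C /\ \bigcup_(U in D) U = [set: X].

Definition aura_compact : Prop :=
  forall C, aura_cover C -> exists D, subcover C D /\ finite_set D.

Definition aura_lindelof : Prop :=
  forall C, aura_cover C -> exists D, subcover C D /\ countable D.

(* `countable` includes the finite sets. *)
Definition countably_aura_compact : Prop :=
  forall C, aura_cover C -> countable C -> exists D, subcover C D /\ finite_set D.

End AuraSpace.

(* Main.v *)
Require Import Defs.
From mathcomp Require Import all_boot all_order all_algebra.
From mathcomp Require Import all_classical topology.

Local Open Scope classical_set_scope.

(** Every aura-open set is open, being a neighbourhood of each of its points ([aura_open_open]). An
    aura cover is thus an ordinary open cover, and compactness, turned from filters into covers by
    [compact_open_subcover], yields a finite subcover. The other two implications are formal: a
    countable cover is a cover, and a finite subfamily is countable. *)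

(* The library's [compact_cover] is only available for pointed spaces. *)
Lemma compact_open_subcover (X : topologicalType) (A : set X)
    (C : set (set X)) :
  compact A -> C `<=` open -> A `<=` \bigcup_(U in C) U ->
  exists D, [/\ D `<=` C, finite_set D & A `<=` \bigcup_(U in D) U].
Proof.
move=> cA Cop AC; apply: contrapT => noD.
pose fin := [set D : set (set X) | D `<=` C /\ finite_set D].
(* The basic sets of [G] are what finite subfamilies of [C] leave uncovered in [A]; each is nonempty
   because no finite subfamily covers [A]. *)
pose G := filter_from fin (fun D => A `\` \bigcup_(U in D) U).
have GP : ProperFilter G.
  apply: filter_from_proper; last first.
    move=> D [DC finD]; apply: contrapT => /nonemptyPn.
    by rewrite setD_eq0 => AD; apply: noD; exists D.
  apply: filter_from_filter.
    by exists set0; split; [exact: sub0set | exact: finite_set0].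
  move=> D E [DC finD] [EC finE]; exists (D `|` E).
    by split; [rewrite subUset; split | rewrite finite_setU].
  by rewrite bigcup_setU setDUr.
have GA : G A.
  exists set0; last exact: subDsetl.
  by split; [exact: sub0set | exact: finite_set0].
have [x [Ax xG]] := cA G GP GA.
have [U CU Ux] := AC x Ax.
(* The cluster point [x] of [G] lies in the open set [U], yet [G] contains [A] minus [U], which
   misses [U]: a contradiction. *)
have GU : G (A `\` U).
  exists [set U]; last by rewrite bigcup_set1.
  by split; [move=> _ -> | exact: finite_set1].
have nU : nbhs x U by apply: open_nbhs_nbhs; split => //; exact: Cop.
by have [y [[_ nUy] Uy]] := xG _ _ GU nU.
Qed.

(** Around each [x] in [A], the scope [a x] is an open neighbourhood of [x] inside [A]. *)
Lemma aura_open_open (X : topologicalType) (a : scope_function X) (A : set X) :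
  aura_open a A -> open A.
Proof.
move=> oA; rewrite openE => x /oA axA.
by apply: filterS axA _; apply: open_nbhs_nbhs; split;
  [exact: scope_open | exact: scope_mem].
Qed.

Lemma compact_aura_compact (X : topologicalType) (a : scope_function X) :
  compact [set: X] -> aura_compact a.
Proof.
move=> cX C [Cop Ccov].
have [U /Cop||D [DC finD Dcov]] := @compact_open_subcover X setT C cX.
- exact: aura_open_open.
- by rewrite Ccov.
exists D; split=> //; split=> //.
by apply/seteqP; split=> // x _; exact: Dcov.
Qed.

Theorem theorem3p8 (X : topologicalType) (a : scope_function X) :
  (compact [set: X] -> aura_compact a) /\
  (aura_compact a -> countably_aura_compact a) /\
  (aura_compact a -> aura_lindelof a).
Proof.
split; first exact: compact_aura_compact.
split=> cX C Ccov; first by move=> _; exact: cX.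
have [D [DC finD]] := cX C Ccov.
by exists D; split=> //; exact: finite_set_countable.
Qed.
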